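(* Let $\mathbb{X}$ be a real Hilbert space, let $\mathbf x_1,\dots,\mathbf x_k\in\mathbb X$ and let $\mathbf u\in\mathbb X$ with $\|\mathbf u\|_{\mathbb X}<1$. Let $T_{k+1}=\{\mathbf w\in[0,1]^{k+1}:w_1+\dots+w_{k+1}=1\}$. Then any geometric quantile of $\mathbf x_1,\dots,\mathbf x_k$ with parameter $\mathbf u$ is given by $$\frac{1}{1-w^*_{k+1}}\Big(\sum_{i=1}^kw_i^*\mathbf x_i+w^*_{k+1}\mathbf u\Big),$$ where $(w_1^*,\dots,w_{k+1}^* )$ is given by $$\underset{\mathbf w\in T_{k+1}}{\arg\min}\ \sum_{i=1}^k\bigg\|\mathbf x_i-\frac{1}{1-w_{k+1}}\Big(\sum_{l=1}^kw_l\mathbf x_l+w_{k+1}\mathbf u\Big)\bigg\|_{\mathbb X}+\bigg\langle\mathbf u,\ \mathbf x_i-\frac{1}{1-w_{k+1}}\Big(\sum_{l=1}^kw_l\mathbf x_l+w_{k+1}\mathbf u\Big)\bigg\rangle.$$ In particular, if $\mathbf y^*$ is a geometric quantile and $\mathbf y^*\neq\mathbf x_i$ for $i=1,\dots,k$, then $$w_i^*=\frac{\|\mathbf x_i-\mathbf y^*\|_{\mathbb X}^{-1}}{\sum_{j=1}^k\|\mathbf x_j-\mathbf y^*\|_{\mathbb X}^{-1}+k}\quad\text{for } i=1,\dots,k,\qquad\text{and}\qquad w_{k+1}^*=\frac{k}{\sum_{j=1}^k\|\mathbf x_j-\mathbf y^*\|_{\mathbb X}^{-1}+k}.$$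
   Context: A geometric quantile of $\mathbf x_1,\dots,\mathbf x_k$ with parameter $\mathbf u$ is an element of $\arg\min_{\mathbf y\in\mathbb X}\sum_{i=1}^k\|\mathbf x_i-\mathbf y\|_{\mathbb X}+\langle\mathbf u,\mathbf x_i-\mathbf y\rangle$, with $\mathbb X^*$ identified with $\mathbb X$ and $\langle\cdot,\cdot\rangle$ the inner product. It is not assumed to be unique. The objective function in $\mathbf w$ is understood for $w_{k+1}<1$. *)

(* Defs.v *)
From HB Require Import structures.
From mathcomp Require Import all_boot all_order all_algebra.
From mathcomp Require Import all_classical all_reals all_analysis.
Set Implicit Arguments.
Unset Strict Implicit.
Unset Printing Implicit Defensive.
Import Order.TTheory GRing.Theory Num.Theory.
Import numFieldNormedType.Exports.
Local Open Scope classical_set_scope.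
Local Open Scope ring_scope.

(* A real Hilbert space is a complete normed module [X] over a [realType]
   together with [ip : {dot X for idfun}] (a symmetric, positive definite
   bilinear form) such that [hilbert_norm ip] holds. *)
Definition hilbert_norm (R : realType) (X : completeNormedModType R)
    (ip : {dot X for (@idfun R)}) : Prop :=
  forall x : X, `|x| = Num.sqrt (ip x x).

Definition argmin (R : realType) (T : Type) (D : set T) (f : T -> R) : set T :=
  [set t | D t /\ forall s, D s -> f t <= f s].

Section GeometricQuantile.
Variables (R : realType) (X : completeNormedModType R).
Variable ip : {dot X for (@idfun R)}.
Variables (k : nat) (x : 'I_k -> X) (u : X).

Definition quantile_objective (y : X) : R :=
  \sum_(i < k) (`|x i - y| + ip u (x i - y)).

Definition geometric_quantile : set X := argmin setT quantile_objective.

(* A weight vector (w_1, ..., w_{k+1}) is a row [w : 'rV[R]_k.+1]: the weight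
   w_i of x_i is [weight w i], and w_{k+1} is [last_weight w]. *)
Definition weight (w : 'rV[R]_k.+1) (i : 'I_k) : R :=
  w ord0 (widen_ord (leqnSn k) i).

Definition last_weight (w : 'rV[R]_k.+1) : R := w ord0 ord_max.

Definition weight_simplex : set 'rV[R]_k.+1 :=
  [set w | (forall j, 0 <= w ord0 j <= 1) /\ \sum_(j < k.+1) w ord0 j = 1].

Definition weighted_point (w : 'rV[R]_k.+1) : X :=
  (1 - last_weight w)^-1 *:
    (\sum_(i < k) weight w i *: x i + last_weight w *: u).

Definition weight_objective (w : 'rV[R]_k.+1) : R :=
  \sum_(i < k) (`|x i - weighted_point w| + ip u (x i - weighted_point w)).

(* The constraint w_{k+1} < 1 is explicit because at w_{k+1} = 1 the inverse
   in [weighted_point] takes the junk value 0^-1 = 0. *)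
Definition optimal_weights : set 'rV[R]_k.+1 :=
  argmin (weight_simplex `&` [set w | last_weight w < 1]) weight_objective.

End GeometricQuantile.

(* Main.v *)
Require Import Defs.
From HB Require Import structures.
From mathcomp Require Import all_boot all_order all_algebra.
From mathcomp Require Import all_classical all_reals all_analysis.
From mathcomp Require Import ring lra.
Import Order.TTheory GRing.Theory Num.Theory.
Import numFieldNormedType.Exports.
Local Open Scope classical_set_scope.
Local Open Scope ring_scope.

(** Dividing the weights by [1 - last_weight w] shows that the weighted points
are exactly the points of [C = {c + s u : c a convex combination of the x_i,
s >= 0}] ([hull_plus_rayP]).  Minimizing over the weights therefore means
minimizing the quantile objective [f] over [C], and the theorem amounts to two
facts about [f].

_Every quantile lies in [C]._  A quantile [y] equal to some [x_i] is in [C]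
trivially.  Otherwise [f] is differentiable at [y], and the vanishing of its
gradient reads [sum_i (x_i - y) / |x_i - y| + k u = 0]
([quantile_stationary]).  With [S = sum_i 1 / |x_i - y|] this is
[S y = sum_i x_i / |x_i - y| + k u], and dividing by [S + k] gives the announced
weights ([quantile_weights]).

_The infimum of [f] over [C] is its infimum over the whole space._  Let [p] be
the projection of an arbitrary [z] onto [C], so that [ip (z - p) (c - p) <= 0]
for all [c] in [C].  Taking [c = x_i] gives [|x_i - p| <= |x_i - z|], and taking
[c = p + u] gives [ip u (z - p) <= 0]; summing over [i], [f p <= f z].  Only
values of [f] are compared, so an approximate projection is enough
([approx_projection], [approx_minimizer_in_convex]): the definition of an
infimum provides it, whereas an exact one would rest on [C] being closed.  Hence a
minimizer of [f] on [C] is a quantile ([quantile_of_optimal_weights]). *)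

(** * Inner products and approximate projections *)

Section HilbertGeometry.
Context {R : realType} {X : completeNormedModType R}.
Context {ip : {dot X for (@idfun R)}}.
Hypothesis hip : hilbert_norm ip.

Lemma ipC (a b : X) : ip a b = ip b a.
Proof. by rewrite (hermC (theta := idfun)) expr0 mul1r. Qed.

Lemma ipDr (a b c : X) : ip a (b + c) = ip a b + ip a c.
Proof. exact: linearDr. Qed.

Lemma ipNr (a b : X) : ip a (- b) = - ip a b.
Proof. exact: linearNr. Qed.

Lemma ipZr (a b : X) t : ip a (t *: b) = t * ip a b.
Proof. exact: linearZr_LR. Qed.

Lemma ip_sumr (a : X) k (v : 'I_k -> X) :
  ip a (\sum_(i < k) v i) = \sum_(i < k) ip a (v i).
Proof. exact: linear_sumr. Qed.

Lemma ipDl (a b c : X) : ip (a + b) c = ip a c + ip b c.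
Proof. by rewrite ipC ipDr !(ipC c). Qed.

Lemma normsqE (a : X) : `|a| ^+ 2 = ip a a.
Proof.
rewrite hip sqr_sqrtr //; have [->|/neq0_dnorm_gt0/ltW //] := eqVneq a 0.
by rewrite linear0r.
Qed.

Lemma normsqDZ (a h : X) t :
  `|a + t *: h| ^+ 2 = `|a| ^+ 2 + 2 * t * ip a h + t ^+ 2 * `|h| ^+ 2.
Proof.
rewrite !normsqE ipDr !ipDl !ipZr (ipC (t *: h) a) (ipC (t *: h) h) !ipZr; ring.
Qed.

Definition convex_set (C : set X) :=
  forall a b t, C a -> C b -> 0 <= t <= 1 -> C (a + t *: (b - a)).

(** Comparing an almost nearest point [c] with the point
[c + e *: (c' - c)] gives the variational inequality of the projection up to an
error.  Being within [e ^+ 2] of the infimum of the squared distance is what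
leaves an error of order [e] after division by the step [e]. *)
Lemma approx_projection (C : set X) z e : convex_set C -> C !=set0 ->
  0 < e <= 1 ->
  exists2 c, C c &
    forall c', C c' -> 2 * ip (z - c) (c' - c) <= e * (1 + `|c' - c| ^+ 2).
Proof.
move=> convC [c0 Cc0] /andP[e0 e1].
pose D := [set `|z - c| ^+ 2 | c in C].
have lbD : has_lbound D by exists 0 => _ [c _ <-]; exact: sqr_ge0.
have infD : has_inf D by split => //; exists (`|z - c0| ^+ 2), c0.
have e2 : 0 < e ^+ 2 by rewrite exprn_gt0.
have [_ [c Cc <-] cD] := inf_adherent e2 infD.
exists c => // c' Cc'.
have : inf D <= `|z - (c + e *: (c' - c))| ^+ 2.
  by apply: ge_inf => //; exists (c + e *: (c' - c)) => //;
    apply: convC => //; rewrite ltW.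
have -> : z - (c + e *: (c' - c)) = (z - c) + (- e) *: (c' - c).
  by rewrite opprD addrA scaleNr.
rewrite normsqDZ => le_d.
rewrite -(ler_pM2l e0); lra.
Qed.

(** The approximate form of: the projection of [z] onto [C] is at least as close
as [z] to each [x i], and lies at least as far as [z] in the direction [u]. *)
Lemma approx_dominating_point (C : set X) k (x : 'I_k -> X) u z eta :
  convex_set C -> C !=set0 -> (forall i, C (x i)) ->
  (forall c, C c -> C (c + u)) -> 0 < eta <= 1 ->
  exists c, [/\ C c, forall i, `|x i - c| <= `|x i - z| + eta &
    ip u (z - c) <= eta].
Proof.
move=> convC C0 Cx Cu /andP[eta0 eta1].
(* [B] bounds the errors arising from the points [x i] and [c + u] at once. *)
pose B := 2 + `|u| ^+ 2 + \sum_(i < k) 2 * `|x i - z| ^+ 2.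
have sum0 : 0 <= \sum_(i < k) 2 * `|x i - z| ^+ 2.
  by apply: sumr_ge0 => i _; rewrite mulr_ge0 // sqr_ge0.
have u0 : 0 <= `|u| ^+ 2 by exact: sqr_ge0.
have B2 : 2 <= B by rewrite /B; lra.
pose e := eta ^+ 2 / B.
have eB : e * B = eta ^+ 2 by rewrite /e divfK //; lra.
have e0 : 0 < e by rewrite divr_gt0 ?exprn_gt0 //; lra.
have eta2 : eta ^+ 2 <= eta by nra.
have e12 : e <= 1 / 2 by nra.
have [|c Cc cP] := approx_projection C z e convC C0; first by lra.
exists c; split => // [i|].
- have := cP _ (Cx i).
  have Bi : 2 + 2 * `|x i - z| ^+ 2 <= B.
    rewrite /B (bigD1 i) //=.
    have : 0 <= \sum_(j < k | j != i) 2 * `|x j - z| ^+ 2.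
      by apply: sumr_ge0 => j _; rewrite mulr_ge0 // sqr_ge0.
    lra.
  have := normsqDZ (x i - c) (z - c) (- 1).
  rewrite scaleN1r opprB [x i - c + _]addrA subrK (ipC (z - c)).
  have := normr_ge0 (x i - z); have := sqr_ge0 `|z - c|.
  set A := `|x i - z| in Bi *; set V := `|x i - c|; set q := ip _ _.
  move=> zc0 A0 eqA le_q.
  (* The error of the projection contains [V ^+ 2] itself, hence the factor
     [1 - e], which is then removed using [(1 + 2 * e) * (1 - e) >= 1]. *)
  have V2 : (1 - e) * V ^+ 2 <= A ^+ 2 + e by lra.
  rewrite -(@ler_pXn2r _ 2) ?nnegrE ?normr_ge0 ?addr_ge0 ?(ltW eta0) //.
  have V0 : 0 <= V ^+ 2 by exact: sqr_ge0.
  have h1 : V ^+ 2 <= (1 + 2 * e) * ((1 - e) * V ^+ 2).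
    have : 0 <= e * (1 - 2 * e) * V ^+ 2.
      by apply: mulr_ge0 => //; apply: mulr_ge0; lra.
    lra.
  have h2 : (1 + 2 * e) * ((1 - e) * V ^+ 2) <= (1 + 2 * e) * (A ^+ 2 + e).
    by rewrite ler_pM2l //; lra.
  have h3 : e * (2 + 2 * A ^+ 2) <= e * B by rewrite ler_pM2l.
  have h4 : 0 <= A * eta by rewrite mulr_ge0 // ltW.
  have h5 : e * (2 * e) <= e * 1 by rewrite ler_pM2l //; lra.
  lra.
- have := cP _ (Cu _ Cc); rewrite addrAC subrr add0r (ipC u) => le_u.
  have : e * (1 + `|u| ^+ 2) <= e * B by rewrite ler_pM2l // /B; lra.
  lra.
Qed.

(** * The quantile objective *)

Lemma approx_minimizer_in_convex (C : set X) k (x : 'I_k -> X) u z e :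
  convex_set C -> C !=set0 -> (forall i, C (x i)) ->
  (forall c, C c -> C (c + u)) -> 0 < e ->
  exists2 c, C c &
    quantile_objective ip x u c <= quantile_objective ip x u z + e.
Proof.
move=> convC C0 Cx Cu e0.
(* Each of the [k] terms of the objective loses at most [2 * eta]. *)
pose eta := Num.min 1 (e / (2 * k%:R + 1)).
have k0 : 0 <= k%:R :> R by exact: ler0n.
have etae : eta * (2 * k%:R + 1) <= e.
  by rewrite -ler_pdivlMr ?ge_min ?lexx ?orbT //; lra.
have eta01 : 0 < eta <= 1.
  by rewrite lt_min ge_min lexx ltr01 divr_gt0 //; lra.
have [c [Cc cx cu]] :=
  approx_dominating_point C k x u z eta convC C0 Cx Cu eta01.
exists c => //.
have : quantile_objective ip x u c
    <= \sum_(i < k) (`|x i - z| + ip u (x i - z) + (eta + eta)).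
  apply: ler_sum => i _.
  have := ipDr u (x i - z) (z - c); rewrite addrA subrK.
  by have := cx i; lra.
rewrite big_split /= sumr_const card_ord -mulr_natl.
rewrite -/(quantile_objective ip x u z).
move: eta01 => /andP[eta0 _]; lra.
Qed.

(** Concavity of the square root bounds the norm by a quadratic function tangent
to it at [a]; this one-sided estimate replaces the derivative of the norm. *)
Lemma norm_le_tangent (a h : X) : a != 0 ->
  `|a + h| <= `|a| + `|a|^-1 * (ip a h + `|h| ^+ 2 / 2).
Proof.
move=> a0; have na0 : 0 < `|a| by rewrite normr_gt0.
have := normsqDZ a h 1; rewrite scale1r => sqE.
rewrite -(ler_pM2l na0) mulrDr mulVKf ?gt_eqF //.
have := sqr_ge0 (`|a| - `|a + h|); lra.
Qed.

(** The sum [g] is minus the gradient of the objective at [y], so a step along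
[g] would decrease the objective unless [g] vanishes. *)
Lemma quantile_stationary k (x : 'I_k -> X) u y : (0 < k)%N ->
  geometric_quantile ip x u y -> (forall i, x i - y != 0) ->
  \sum_(i < k) `|x i - y|^-1 *: (x i - y) + k%:R *: u = 0.
Proof.
move=> k0 [_ ymin] xy0.
set g := _ + _; set S := \sum_(i < k) `|x i - y|^-1.
have S0 : 0 < S.
  rewrite /S (bigD1 (Ordinal k0)) //= ltr_pwDl ?invr_gt0 ?normr_gt0 //.
  by apply: sumr_ge0 => i _; rewrite invr_ge0.
(* The step [t] minimizes the quadratic upper bound
   [- t * `|g| ^+ 2 + t ^+ 2 * `|g| ^+ 2 / 2 * S]. *)
pose t := S^-1.
have : quantile_objective ip x u (y + t *: g) <=
    quantile_objective ip x u y - t * ip g g + t ^+ 2 * `|g| ^+ 2 / 2 * S.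
  have -> : ip g g = \sum_(i < k) (`|x i - y|^-1 * ip (x i - y) g + ip u g).
    rewrite big_split /= sumr_const card_ord -mulr_natl (ipC u).
    rewrite -ipZr {2}/g ipDr ip_sumr; congr (_ + _).
    by apply: eq_bigr => i _; rewrite ipZr ipC.
  rewrite mulr_sumr -sumrN mulr_sumr -!big_split /=; apply: ler_sum => i _.
  have := norm_le_tangent (x i - y) (- (t *: g)) (xy0 i).
  have -> : x i - (y + t *: g) = x i - y - t *: g by rewrite opprD addrA.
  rewrite (ipDr u) !ipNr !ipZr normrN normrZ exprMn real_normK ?num_real //.
  lra.
have := ymin (y + t *: g) I; rewrite -normsqE => le1 le2.
have tS : t * S = 1 by rewrite mulVf // gt_eqF.
have t0 : 0 < t by rewrite invr_gt0.
have : t * `|g| ^+ 2 <= 0.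
  have -> : t * `|g| ^+ 2 = 2 * (t * `|g| ^+ 2 - t * `|g| ^+ 2 * (t * S) / 2).
    by rewrite tS; field.
  lra.
by rewrite pmulr_rle0 // exprn_even_le0 //= normr_eq0 => /eqP.
Qed.

End HilbertGeometry.

(** * Weighted points as a convex hull plus a ray *)

Section Weights.
Context {R : realType} {X : completeNormedModType R} {k : nat}.
Variables (x : 'I_k -> X) (u : X).

Definition weights_of (v : 'I_k -> R) (t : R) : 'rV[R]_k.+1 :=
  \row_j oapp v t (unlift ord_max j).

Lemma widen_ord_lift (i : 'I_k) : widen_ord (leqnSn k) i = lift ord_max i.
Proof. by apply: val_inj; rewrite /= /bump leqNgt ltn_ord. Qed.

Lemma weight_weights_of v t i : weight (weights_of v t) i = v i.
Proof. by rewrite /weight mxE widen_ord_lift liftK. Qed.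

Lemma last_weight_weights_of v t : last_weight (weights_of v t) = t.
Proof. by rewrite /last_weight mxE unlift_none. Qed.

(** The upper bounds on the weights follow from nonnegativity and the sum. *)
Lemma weight_simplexP (w : 'rV[R]_k.+1) : weight_simplex w <->
  [/\ forall i, 0 <= weight w i, 0 <= last_weight w &
    \sum_(i < k) weight w i + last_weight w = 1].
Proof.
split => [[w01 w1]|[w0 l0 w1]].
  split => [i||]; [by case/andP: (w01 (widen_ord (leqnSn k) i))| |].
    by case/andP: (w01 ord_max).
  by rewrite -w1 big_ord_recr.
have w0' j : 0 <= w ord0 j.
  case: (unliftP ord_max j) => [i ->|-> //].
  by rewrite -widen_ord_lift; exact: w0.
have sumw : \sum_(j < k.+1) w ord0 j = 1 by rewrite big_ord_recr.
split => // j; rewrite w0' -sumw (bigD1 j) //= lerDl.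
by apply: sumr_ge0.
Qed.

Definition hull_plus_ray : set X :=
  [set y | exists (a : 'I_k -> R) s, [/\ forall i, 0 <= a i,
     \sum_(i < k) a i = 1, 0 <= s & y = \sum_(i < k) a i *: x i + s *: u]].

(** With [t] the last weight, [w |-> (w_i / (1 - t), t / (1 - t))] is a
bijection onto the pairs (convex weights, nonnegative multiple of [u]), with inverse
[(a, s) |-> (a_i / (1 + s), s / (1 + s))]. *)
Lemma hull_plus_rayP y : hull_plus_ray y <->
  exists2 w, weight_simplex w /\ last_weight w < 1 & y = weighted_point x u w.
Proof.
split => [[a [s [a0 a1 s0 ->]]]|[w [/weight_simplexP[w0 l0 w1] l1] ->]].
  have s1 : 1 + s != 0 by rewrite gt_eqF //; lra.
  exists (weights_of (fun i => a i / (1 + s)) (s / (1 + s))).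
    split; last by rewrite last_weight_weights_of ltr_pdivrMr; lra.
    apply/weight_simplexP; rewrite last_weight_weights_of.
    split=> [i||]; first by rewrite weight_weights_of divr_ge0 //; lra.
      by rewrite divr_ge0 //; lra.
    under eq_bigr do rewrite weight_weights_of.
    by rewrite -mulr_suml a1 -mulrDl divff.
  rewrite /weighted_point last_weight_weights_of.
  have -> : (1 - s / (1 + s))^-1 = 1 + s.
    rewrite (_ : 1 - _ = (1 + s)^-1) ?invrK //; by field.
  rewrite scalerDr scaler_sumr scalerA mulrCA divff // mulr1; congr (_ + _).
  by apply: eq_bigr => i _; rewrite weight_weights_of scalerA mulrCA divff //
    mulr1.
have l1' : 1 - last_weight w != 0 by rewrite subr_eq0 gt_eqF.
exists (fun i => (1 - last_weight w)^-1 * weight w i).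
exists ((1 - last_weight w)^-1 * last_weight w); split.
- by move=> i; rewrite mulr_ge0 // invr_ge0; lra.
- by rewrite -mulr_sumr -[RHS](mulVf l1'); congr (_ * _); lra.
- by rewrite mulr_ge0 // invr_ge0; lra.
- rewrite /weighted_point scalerDr scaler_sumr scalerA; congr (_ + _).
  by apply: eq_bigr => i _; rewrite scalerA.
Qed.

Lemma hull_plus_ray_convex : convex_set hull_plus_ray.
Proof.
move=> _ _ t [a [r [a0 a1 r0 ->]]] [b [s [b0 b1 s0 ->]]] /andP[t0 t1].
exists (fun i => a i + t * (b i - a i)), (r + t * (s - r)); split.
- move=> i; have : 0 <= (1 - t) * a i + t * b i.
    by apply: addr_ge0; apply: mulr_ge0 => //; lra.
  lra.
- by rewrite big_split /= -mulr_sumr sumrB a1 b1; lra.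
- have : 0 <= (1 - t) * r + t * s.
    by apply: addr_ge0; apply: mulr_ge0 => //; lra.
  lra.
- rewrite opprD addrACA -sumrB -scalerBl scalerDr scaler_sumr scalerA.
  rewrite addrACA -big_split /= -scalerDl; congr (_ + _).
  by apply: eq_bigr => i _; rewrite -scalerBl scalerA -scalerDl.
Qed.

Lemma hull_plus_ray_point i : hull_plus_ray (x i).
Proof.
exists (fun j => (j == i)%:R), 0; split => [j||//|].
- exact: ler0n.
- by rewrite (bigD1 i) //= eqxx big1 ?addr0 // => j /negPf ->.
- rewrite scale0r addr0 (bigD1 i) //= eqxx scale1r.
  rewrite big1 ?addr0 // => j /negPf ->.
  by rewrite scale0r.
Qed.

Lemma hull_plus_ray_shift c : hull_plus_ray c -> hull_plus_ray (c + u).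
Proof.
move=> [a [s [a0 a1 s0 ->]]]; exists a, (s + 1); split => //; first by lra.
by rewrite -addrA scalerDl scale1r.
Qed.

End Weights.

(** * Quantiles and optimal weights *)

Section Quantiles.
Context {R : realType} {X : completeNormedModType R}.
Context {ip : {dot X for (@idfun R)}}.
Hypothesis hip : hilbert_norm ip.
Context {k : nat}.
Hypothesis k_gt0 : (0 < k)%N.
Context {x : 'I_k -> X} {u : X}.

Lemma optimal_weights_of_quantile w :
  weight_simplex w -> last_weight w < 1 ->
  geometric_quantile ip x u (weighted_point x u w) ->
  optimal_weights ip x u w.
Proof. by move=> ws wl [_ wmin]; split => // w' _; exact: wmin. Qed.

(** Any [z] is dominated, up to [e], by a weighted point, which in turn is
dominated by the optimal one. *)
Lemma quantile_of_optimal_weights w :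
  optimal_weights ip x u w ->
  geometric_quantile ip x u (weighted_point x u w).
Proof.
move=> [_ wmin]; split => // z _; apply/ler_addgt0Pr => e e0.
have [|c /hull_plus_rayP[w' w's ->] le_c] :=
  approx_minimizer_in_convex hip (hull_plus_ray x u) k x u z e
    (hull_plus_ray_convex x u) _ (hull_plus_ray_point x u)
    (hull_plus_ray_shift x u) e0.
  by exists (x (Ordinal k_gt0)); exact: hull_plus_ray_point.
exact: le_trans (wmin _ w's) le_c.
Qed.

(** The weights are the coefficients of the stationarity equation, solved for
[y] and normalized to sum to [1]. *)
Lemma quantile_weights y :
  geometric_quantile ip x u y -> (forall i, y <> x i) ->
  let S := \sum_(j < k) `|x j - y|^-1 in
  let w :=
    weights_of (fun i => `|x i - y|^-1 / (S + k%:R)) (k%:R / (S + k%:R)) in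
  [/\ weight_simplex w, last_weight w < 1 & y = weighted_point x u w].
Proof.
move=> yq yx S w.
have xy0 i : x i - y != 0 by rewrite subr_eq0; apply/eqP => /esym /yx.
have S0 : 0 < S.
  rewrite /S (bigD1 (Ordinal k_gt0)) //= ltr_pwDl ?invr_gt0 ?normr_gt0 //.
  by apply: sumr_ge0 => i _; rewrite invr_ge0.
have k0 : 0 < k%:R :> R by rewrite ltr0n.
have Sk0 : S + k%:R != 0 by rewrite gt_eqF // addr_gt0.
have wl : 1 - last_weight w = S / (S + k%:R).
  by rewrite last_weight_weights_of; field.
have wl0 : 0 < S / (S + k%:R) by rewrite divr_gt0 ?addr_gt0.
split; [apply/weight_simplexP; split | lra | ].
- by move=> i; rewrite weight_weights_of divr_ge0 ?invr_ge0 ?addr_ge0 // ltW.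
- by rewrite last_weight_weights_of divr_ge0 ?addr_ge0 // ltW.
- rewrite last_weight_weights_of; under eq_bigr do rewrite weight_weights_of.
  by rewrite -mulr_suml -mulrDl divff.
have := quantile_stationary hip k x u y k_gt0 yq xy0.
under eq_bigr do rewrite scalerBr.
rewrite sumrB -scaler_suml -/S => /eqP; rewrite addrAC subr_eq0 => /eqP stat.
rewrite /weighted_point wl last_weight_weights_of.
under eq_bigr do rewrite weight_weights_of mulrC -scalerA.
rewrite -scaler_sumr [k%:R / _]mulrC -scalerA -scalerDr stat !scalerA.
rewrite [X in X *: _](_ : _ = 1) ?scale1r //.
by field; rewrite Sk0 gt_eqF.
Qed.

End Quantiles.

Theorem theorem4p21 (R : realType) (X : completeNormedModType R)
    (ip : {dot X for (@idfun R)}) (hip : hilbert_norm ip)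
    (k : nat) (hk : (0 < k)%N) (x : 'I_k -> X) (u : X) (hu : `|u| < 1) :
  (forall y : X, geometric_quantile ip x u y <->
     exists2 w, optimal_weights ip x u w & y = weighted_point x u w) /\
  (forall y : X, geometric_quantile ip x u y -> (forall i, y <> x i) ->
     exists w, [/\ optimal_weights ip x u w, y = weighted_point x u w,
       forall i, weight w i =
         `|x i - y|^-1 / (\sum_(j < k) `|x j - y|^-1 + k%:R) &
       last_weight w = k%:R / (\sum_(j < k) `|x j - y|^-1 + k%:R)]).
Proof.
have distinct y : geometric_quantile ip x u y -> (forall i, y <> x i) ->
    exists w, [/\ optimal_weights ip x u w, y = weighted_point x u w,
      forall i, weight w i =
        `|x i - y|^-1 / (\sum_(j < k) `|x j - y|^-1 + k%:R) &
      last_weight w = k%:R / (\sum_(j < k) `|x j - y|^-1 + k%:R)].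
  move=> yq yx; have [ws wl yw] := quantile_weights hip hk y yq yx.
  eexists; split; [| exact: yw | exact: weight_weights_of
                  | exact: last_weight_weights_of].
  by apply: optimal_weights_of_quantile => //; rewrite -yw.
split => // y; split => [yq|[w wo ->]]; last exact: quantile_of_optimal_weights.
(* At [y = x i] the objective may fail to be differentiable, but [x i] is itself
   a weighted point. *)
have [[i yxi]|yx] := pselect (exists i, y = x i); last first.
  have [|w [wo yw _ _]] := distinct y yq; last by exists w.
  by move=> i yxi; apply: yx; exists i.
have /hull_plus_rayP[w [ws wl] yw] := hull_plus_ray_point x u i.
exists w; last by rewrite yxi.
by apply: optimal_weights_of_quantile => //; rewrite -yw -yxi.
Qed.
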